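(* Consider an operational probabilistic theory (OPT) satisfying Property ($\diamondsuit$) and the local equality postulate, with matrix representations $\mathcal M^A:\mathbf V_A\to\mathbf M_A$ of all systems fixed as in the context. For any systems $A$ and $B$, $\mathbf{Proc}_{A\to B}$ and $\mathbf{CP}_{A\to B}$ are isomorphic as convex cones. Also, there exists an isomorphism $\mathcal L:\mathbf{Proc}_{A\to B}\ni f\mapsto\mathcal L_f\in\mathbf{CP}_{A\to B}$ such that $$\mathcal M^B_{f\circ|\rho)}=\mathcal L_f\big[\mathcal M^A_{|\rho)}\big]\qquad\text{for all } f\in\mathbf{Proc}_{A\to B},\ |\rho)\in\mathbf{St}_A .$$
   Context: OPT. An operational theory is a strict symmetric monoidal category: objects are systems (unit: the trivial system $I$), morphisms are processes, $\mathbf{Proc}_{A\to B}$ is the set of processes from $A$ to $B$, with sequential composition $g\circ f$, parallel composition $A\otimes B$, $f\otimes g$, identities $\mathrm{id}_A$ and swaps. States: $\mathbf{St}_A:=\mathbf{Proc}_{I\to A}\ni|\rho)$; effects: $\mathbf{Eff}_A:=\mathbf{Proc}_{A\to I}\ni(e|$; scalars: $\mathbf{Proc}_{I\to I}$; $(e|\rho):=(e|\circ|\rho)$; $af:=a\otimes f$ for a scalar $a$. A diagram $u:\mathbf{Proc}_{A\to B}\to\mathbf{Proc}_{C\to D}$ is a map $u(f)=u_2\circ(f\otimes\mathrm{id}_E)\circ u_1$ for some system $E$ and processes $u_1\in\mathbf{Proc}_{C\to A\otimes E}$, $u_2\in\mathbf{Proc}_{B\otimes E\to D}$. An OPT is an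 operational theory with, for all $A,B$, a collection of tests (finite families of processes from $A$ to $B$). A process $f$ is deterministic if $\{f\}$ is a test, and feasible if it belongs to some test; a measurement of $A$ is a test from $A$ to $I$. Assumptions: (1) every system has a deterministic state and a deterministic effect; sequential and parallel compositions of tests (all pairwise composites) are tests. (2) The scalars are $\mathbb R_{\ge0}$, the feasible scalars are $[0,1]$, composition of scalars is multiplication, $\mathrm{id}_I=1$, and every process is $af$ with $a\ge0$ and $f$ feasible. (3) The deterministic effect $(\top_A|$ of each $A$ is unique, $(\top_{A\otimes B}|=(\top_A|\otimes(\top_B|$, and a finite family $\{f_j\}$ in $\mathbf{Proc}_{A\to B}$ is a test iff $\sum_j(\top_{B\otimes E}|\circ(f_j\otimes\mathrm{id}_E)\circ|\sigma)=(\top_{A\otimes E}|\sigma)$ for all $E$ and $|\sigma)\in\mathbf{St}_{A\otimes E}$. (4) $f,f'\in\mathbf{Proc}_{A\to B}$ are equal iff $u(f)=u(f')$ for all scalar-valued diagrams $u$. (5) For feasible $g_1,g_2\in\mathbf{Proc}_{A\to B}$ and $p\in[0,1]$ there is a feasible $h$ with $u(h)=p\,u(g_1)+(1-p)u(g_2)$ for all scalar-valued diagrams $u$. Hence each $\mathbf{Proc}_{A\to B}$ is a convex cone, with sums determined by $u(f_1+f_2)=u(f_1)+u(f_2)$. (6) The real vector space $\mathbf V_{A\to B}$ spanned by $\mathbf{Proc}_{A\to B}$ (formal real combinations, identified when all scalar-valued diagrams agree) is finite-dimensional. Put $\mathbf V_A:=\mathbf V_{I\to A}$, $\mathbf V_A^*:=\mathbf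 V_{A\to I}$, the latter being the dual space of $\mathbf V_A$; compositions extend bilinearly. (7) The set of normalized states $\mathbf{St}^{\mathrm N}_A:=\{|\rho)\in\mathbf{St}_A:(\top_A|\rho)=1\}$ is closed. Local equality postulate: if $f,f'\in\mathbf{Proc}_{A\to B}$ satisfy $(e|\circ f\circ|\rho)=(e|\circ f'\circ|\rho)$ for all $|\rho)\in\mathbf{St}_A$, $(e|\in\mathbf{Eff}_B$, then $f=f'$. Property ($\diamondsuit$): for each system $A$, $\mathbf{St}_A$ is a symmetric cone in $\mathbf V_A$ and $\mathbf{Eff}_A=\mathbf{St}_A^*:=\{(e|\in\mathbf V_A^*:(e|\rho)\ge0\ \forall|\rho)\in\mathbf{St}_A\}$. A cone $\mathcal C$ in $\mathbf V$ is symmetric if it is self-dual ($\mathcal C=\{x\in\mathbf V:\langle x,y\rangle\ge0\ \forall y\in\mathcal C\}$ for some inner product) and homogeneous (for any interior points $x,y$ there is a linear automorphism of $\mathcal C$ mapping $x$ to $y$). Here $x\in\mathcal C$ is an interior point if for every $y\in\mathcal C$ there is $\delta>0$ with $x-\delta y\in\mathcal C$. Matrix representations. In such an OPT, $\mathbf{St}_A\cong\bigoplus_{i=1}^{k_A}\mathcal S_+(\mathbb C^{n_i})$ for each $A$, where $\mathcal S_+(\mathbb C^n)$ is the cone of complex positive semidefinite $n\times n$ matrices and $\mathcal S(\mathbb C^n)$ denotes the complex Hermitian $n\times n$ matrices; put $N_A=\sum_in_i$. For each $A$ there is fixed a set of mutually orthogonal projection matrices $\mathcal P_A=\{P_{A,i}\}_{i=1}^{k_A}$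 of order $N_A$ with $\mathrm{rank}\,P_{A,i}=n_i$ (so $\sum_iP_{A,i}$ is the identity matrix). Let $\mathbf M_A:=\{\sum_iH_i: H_i\in\mathcal S(\mathbb C^{N_A}),\ P_{A,i}H_iP_{A,i}=H_i\}$ and let $\mathbf M_A^+$ be the set of positive semidefinite matrices in $\mathbf M_A$. $\mathcal M^A:\mathbf V_A\to\mathbf M_A$, $|x)\mapsto\mathcal M^A_{|x)}$, is a linear isomorphism with $\mathcal M^A(\mathbf{St}_A)=\mathbf M_A^+$ and $\mathrm{Tr}\,\mathcal M^A_{|x)}=(\top_A|x)$ for all $|x)\in\mathbf V_A$. The choices are compatible with composition: $\mathcal P_{A\otimes B}=\{P_{A,i}\otimes P_{B,j}\}_{i,j}$ and $\mathcal M^{A\otimes B}_{|x)\otimes|y)}=\mathcal M^A_{|x)}\otimes\mathcal M^B_{|y)}$ (Kronecker product) for all systems $A,B$, $|x)\in\mathbf V_A$, $|y)\in\mathbf V_B$. $\mathbf{CP}_{A\to B}$ is the convex cone of completely positive (CP) linear maps from $\mathbf M_A$ to $\mathbf M_B$. *)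

(* Defs.v *)
From HB Require Import structures.
From mathcomp Require Import all_boot all_order all_algebra.
From mathcomp Require Import mxtens complex.
From mathcomp Require Import all_classical all_reals all_analysis.

Set Implicit Arguments.
Unset Strict Implicit.
Unset Printing Implicit Defensive.

Import Order.TTheory GRing.Theory Num.Theory.
Import numFieldNormedType.Exports.
Local Open Scope classical_set_scope.
Local Open Scope ring_scope.
Local Open Scope sesquilinear_scope.
Local Open Scope complex_scope.

(* Strictness makes associativity and unitality of the tensor product equalities
   between objects; [castp] transports a morphism along such equalities. *)
Definition castp (S : Type) (P : S -> S -> Type) (A A' B B' : S)
    (eA : A = A') (eB : B = B') (f : P A B) : P A' B' :=
  match eA in _ = X, eB in _ = Y return P X Y with erefl, erefl => f end.

Record smcat := SMCat {
  sys :> Type;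
  proc : sys -> sys -> Type;
  triv : sys;
  tens : sys -> sys -> sys;
  idp : forall A, proc A A;
  seqp : forall A B C, proc B C -> proc A B -> proc A C;
  par : forall A B C D, proc A B -> proc C D -> proc (tens A C) (tens B D);
  swap : forall A B, proc (tens A B) (tens B A);
  tensA : forall A B C, tens A (tens B C) = tens (tens A B) C;
  tens1s : forall A, tens triv A = A;
  tenss1 : forall A, tens A triv = A;
  seqpA : forall A B C D (h : proc C D) (g : proc B C) (f : proc A B),
    seqp h (seqp g f) = seqp (seqp h g) f;
  comp1p : forall A B (f : proc A B), seqp (idp B) f = f;
  compp1 : forall A B (f : proc A B), seqp f (idp A) = f;
  par_id : forall A B, par (idp A) (idp B) = idp (tens A B);
  par_comp : forall A B C A' B' C'
      (g : proc B C) (f : proc A B) (g' : proc B' C') (f' : proc A' B'),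
    par (seqp g f) (seqp g' f') = seqp (par g g') (par f f');
  parA : forall A B C D E F (f : proc A B) (g : proc C D) (h : proc E F),
    castp (tensA A C E) (tensA B D F) (par f (par g h)) = par (par f g) h;
  par1p : forall A B (f : proc A B),
    castp (tens1s A) (tens1s B) (par (idp triv) f) = f;
  parp1 : forall A B (f : proc A B),
    castp (tenss1 A) (tenss1 B) (par f (idp triv)) = f;
  swap_nat : forall A B C D (f : proc A B) (g : proc C D),
    seqp (swap B D) (par f g) = seqp (par g f) (swap A C);
  swapK : forall A B, seqp (swap B A) (swap A B) = idp (tens A B);
  swap_hex : forall A B C,
    castp (tensA A B C) (esym (tensA B C A)) (swap A (tens B C)) =
    seqp (par (idp B) (swap A C))
        (castp erefl (esym (tensA B A C)) (par (swap A B) (idp C)))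
}.

Arguments proc {s}. Arguments triv {s}. Arguments tens {s}.
Arguments idp {s}. Arguments seqp {s A B C}. Arguments par {s A B C D}.
Arguments swap {s}.
Arguments tensA {s}. Arguments tens1s {s}. Arguments tenss1 {s}.

Notation St A := (proc triv A).
Notation Eff A := (proc A triv).
Notation Scal T := (proc (@triv T) (@triv T)).

(* [a f := a (x) f] *)
Definition smulp (T : smcat) (A B : T) (a : Scal T) (f : proc A B) :
  proc A B := castp (tens1s A) (tens1s B) (par a f).

(* [rho (x) sigma], with domain [I (x) I = I] *)
Definition tens_st (T : smcat) (A B : T) (rho : St A) (sigma : St B) :
  St (tens A B) := castp (tens1s triv) erefl (par rho sigma).

Record diagram (T : smcat) (A B C D : T) := Diagram {
  anc : T;
  dpre : proc C (tens A anc);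
  dpost : proc (tens B anc) D
}.

Definition dapp (T : smcat) (A B C D : T) (u : diagram A B C D)
    (f : proc A B) : proc C D :=
  seqp (dpost u) (seqp (par f (idp (anc u))) (dpre u)).

Notation sdiagram A B := (diagram A B triv triv).

Record testcat := TestCat {
  tc_cat :> smcat;
  test : forall (A B : tc_cat) (J : finType), (J -> proc A B) -> Prop
}.

Definition deterministic (T : testcat) (A B : T) (f : proc A B) : Prop :=
  test (fun _ : unit => f).

Definition feasible (T : testcat) (A B : T) (f : proc A B) : Prop :=
  exists (J : finType) (F : J -> proc A B) (j : J), test F /\ F j = f.

(* Everything except what is formulated in terms of the vector spaces [V]
   below, whose construction depends on this structure. *)
Record preopt (R : realType) := PreOpt {
  po_tc :> testcat;
  (* the identification of the scalars with the nonnegative reals *)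
  scal : Scal po_tc -> R;
  top : forall A : po_tc, Eff A;

  det_state : forall A : po_tc, exists rho : St A, deterministic rho;
  test_comp : forall (A B C : po_tc) (J K : finType)
      (F : J -> proc A B) (G : K -> proc B C),
    test F -> test G -> test (fun jk : J * K => seqp (G jk.2) (F jk.1));
  test_par : forall (A B C D : po_tc) (J K : finType)
      (F : J -> proc A B) (G : K -> proc C D),
    test F -> test G -> test (fun jk : J * K => par (F jk.1) (G jk.2));

  scal_inj : injective scal;
  scal_range : range scal = [set x | 0 <= x];
  scal_comp : forall a b, scal (seqp a b) = scal a * scal b;
  scal_id : scal (idp triv) = 1;
  scal_feasible : forall a, feasible a <-> 0 <= scal a <= 1;
  proc_feasible : forall (A B : po_tc) (f : proc A B),
    exists (a : Scal po_tc) (g : proc A B), feasible g /\ f = smulp a g;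

  top_det : forall A, deterministic (top A);
  top_unique : forall A (e : Eff A), deterministic e -> e = top A;
  top_tens : forall A B,
    top (tens A B) = castp erefl (tens1s triv) (par (top A) (top B));
  testP : forall (A B : po_tc) (J : finType) (F : J -> proc A B),
    test F <->
    forall (E : po_tc) (sigma : St (tens A E)),
      \sum_(j : J) scal (seqp (top (tens B E))
                             (seqp (par (F j) (idp E)) sigma))
      = scal (seqp (top (tens A E)) sigma);

  proc_ext : forall (A B : po_tc) (f f' : proc A B),
    f = f' <-> (forall u : sdiagram A B, dapp u f = dapp u f');

  proc_convex : forall (A B : po_tc) (g1 g2 : proc A B) (p : R),
    feasible g1 -> feasible g2 -> 0 <= p <= 1 ->
    exists h : proc A B, feasible h /\
      forall u : sdiagram A B,
        scal (dapp u h) = p * scal (dapp u g1) + (1 - p) * scal (dapp u g2)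
}.

Arguments scal {R _}. Arguments top {R _}.

(* A formal real combination [sum_i a_i f_i], up to the identification of
   combinations on which all scalar-valued diagrams agree, is the same thing as
   the function [u |-> sum_i a_i u(f_i)] on scalar-valued diagrams. *)
Definition evp (R : realType) (T : preopt R) (A B : T) (f : proc A B) :
  sdiagram A B -> R^o := fun u => scal (dapp u f).

Definition pspan (R : realType) (T : preopt R) (A B : T) :
  {pred (sdiagram A B -> R^o)} :=
  fun x => `[< exists s : seq (R * proc A B),
                 x = \sum_(p <- s) p.1 *: evp p.2 >].

Lemma pspan_submod (R : realType) (T : preopt R) (A B : T) :
  submod_closed (@pspan R T A B).
Proof.
split; first by apply/asboolP; exists [::]; rewrite big_nil.
move=> a x y /asboolP[s ->] /asboolP[t ->]; apply/asboolP.
exists ([seq (a * p.1, p.2) | p <- s] ++ t).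
rewrite big_cat big_map scaler_sumr; congr (_ + _).
by apply: eq_bigr => p _; rewrite scalerA.
Qed.

HB.instance Definition _ (R : realType) (T : preopt R) (A B : T) :=
  GRing.isSubmodClosed.Build R (sdiagram A B -> R^o) (@pspan R T A B)
    (@pspan_submod R T A B).

Record V (R : realType) (T : preopt R) (A B : T) := MkV {
  V_fun :> sdiagram A B -> R^o;
  V_funP : V_fun \in @pspan R T A B
}.

HB.instance Definition _ (R : realType) (T : preopt R) (A B : T) :=
  [isSub for @V_fun R T A B].
HB.instance Definition _ (R : realType) (T : preopt R) (A B : T) :=
  [Choice of V A B by <:].
HB.instance Definition _ (R : realType) (T : preopt R) (A B : T) :=
  [SubChoice_isSubZmodule of V A B by <:].
HB.instance Definition _ (R : realType) (T : preopt R) (A B : T) :=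
  [SubZmodule_isSubLmodule of V A B by <:].

Lemma evp_span (R : realType) (T : preopt R) (A B : T) (f : proc A B) :
  evp f \in @pspan R T A B.
Proof. by apply/asboolP; exists [:: (1, f)]; rewrite big_seq1 scale1r. Qed.

Definition vec (R : realType) (T : preopt R) (A B : T) (f : proc A B) : V A B :=
  MkV (evp_span f).

Lemma V_fun_comb (R : realType) (T : preopt R) (A B : T)
    (s : seq (R * proc A B)) :
  V_fun (\sum_(p <- s) p.1 *: vec p.2) = \sum_(p <- s) p.1 *: evp p.2.
Proof.
by elim: s => [|p s IHs]; rewrite ?big_nil ?big_cons //= -IHs.
Qed.

Lemma V_combP (R : realType) (T : preopt R) (A B : T) (x : V A B) :
  exists s : seq (R * proc A B), x = \sum_(p <- s) p.1 *: vec p.2.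
Proof.
case: x => x xP; have /asboolP[s xE] := xP; exists s; apply: val_inj.
by rewrite /= V_fun_comb.
Qed.

Definition comb (R : realType) (T : preopt R) (A B : T) (x : V A B) :
  seq (R * proc A B) := projT1 (cid (V_combP x)).

Lemma combK (R : realType) (T : preopt R) (A B : T) (x : V A B) :
  \sum_(p <- comb x) p.1 *: vec p.2 = x.
Proof. by rewrite /comb; case: cid. Qed.

(* Linear extension along [vec]; it is independent of the choice of [comb x]
   when [phi] respects linear relations, see [lextE]. *)
Definition lext (R : realType) (T : preopt R) (A B : T) (W : lmodType R)
    (phi : proc A B -> W) (x : V A B) : W :=
  \sum_(p <- comb x) p.1 *: phi p.2.

(* [(e|x)] for [e] in [V_A^*] and [x] in [V_A]: the bilinear extension of
   [scal (seqp e rho)], see [pairingE]. *)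
Definition pairing (R : realType) (T : preopt R) (A : T)
    (e : V A triv) (x : V triv A) : R :=
  lext (fun e' => lext (fun rho => scal (seqp e' rho) : R^o) x : R^o) e.

(* [|x) (x) |y)] for [x] in [V_A] and [y] in [V_B]: the bilinear extension of
   [tens_st], see [vtensE]. *)
Definition vtens (R : realType) (T : preopt R) (A B : T)
    (x : V triv A) (y : V triv B) : V triv (tens A B) :=
  lext (fun rho => lext (fun sigma => vec (tens_st rho sigma)) y) x.

Definition vec_compat (R : realType) (T : preopt R) (A B : T) (W : lmodType R)
    (phi : proc A B -> W) : Prop :=
  forall s t : seq (R * proc A B),
    \sum_(p <- s) p.1 *: vec p.2 = \sum_(p <- t) p.1 *: vec p.2 ->
    \sum_(p <- s) p.1 *: phi p.2 = \sum_(p <- t) p.1 *: phi p.2.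

Lemma lextE (R : realType) (T : preopt R) (A B : T) (W : lmodType R)
    (phi : proc A B -> W) :
  vec_compat phi ->
  linear (lext phi) /\ forall f, lext phi (vec f) = phi f.
Proof.
move=> phiP; split=> [a x y|f].
  rewrite /lext scaler_sumr.
  under [X in _ = X + _]eq_bigr do rewrite scalerA.
  rewrite -(big_map (fun p => (a * p.1, p.2)) predT
              (fun p : R * proc A B => p.1 *: phi p.2)) -big_cat.
  apply: phiP; rewrite combK big_cat big_map combK.
  under eq_bigr do rewrite -scalerA.
  by rewrite -scaler_sumr combK.
have := phiP (comb (vec f)) [:: (1, f)].
by rewrite combK !big_seq1 !scale1r => /(_ erefl).
Qed.

Lemma V_sumE (R : realType) (T : preopt R) (A B : T) (s : seq (R * proc A B))
    (u : sdiagram A B) :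
  V_fun (\sum_(p <- s) p.1 *: vec p.2) u =
  \sum_(p <- s) p.1 * scal (dapp u p.2).
Proof.
rewrite V_fun_comb.
by elim: s => [|p s IHs]; rewrite ?big_nil ?big_cons // -IHs.
Qed.

Lemma vec_eqP (R : realType) (T : preopt R) (A B : T)
    (s t : seq (R * proc A B)) :
  \sum_(p <- s) p.1 *: vec p.2 = \sum_(p <- t) p.1 *: vec p.2 <->
  forall u : sdiagram A B, \sum_(p <- s) p.1 * scal (dapp u p.2) =
                           \sum_(p <- t) p.1 * scal (dapp u p.2).
Proof.
split=> [st u|st]; first by rewrite -!V_sumE st.
by apply: val_inj; apply/funext => u; rewrite /= !V_sumE.
Qed.

Lemma vec_inj (R : realType) (T : preopt R) (A B : T) :
  injective (@vec R T A B).
Proof.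
move=> f g fg; apply/proc_ext => u; apply: scal_inj.
exact: (congr1 (fun x : V A B => V_fun x u) fg).
Qed.

Lemma par_lr (T : smcat) (A B C D : T) (f : proc A B) (g : proc C D) :
  par f g = seqp (par f (idp D)) (par (idp A) g).
Proof. by rewrite -par_comp compp1 comp1p. Qed.

Lemma par_rl (T : smcat) (A B C D : T) (f : proc A B) (g : proc C D) :
  par f g = seqp (par (idp B) g) (par f (idp C)).
Proof. by rewrite -par_comp compp1 comp1p. Qed.

Lemma vec_sandwich (R : realType) (T : preopt R) (A B C D : T)
    (g : proc B D) (h : proc C A) (s t : seq (R * proc A B)) :
  \sum_(p <- s) p.1 *: vec p.2 = \sum_(p <- t) p.1 *: vec p.2 ->
  \sum_(p <- s) p.1 *: vec (seqp g (seqp p.2 h)) =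
  \sum_(p <- t) p.1 *: vec (seqp g (seqp p.2 h)).
Proof.
move=> /vec_eqP st.
have E (r : seq (R * proc A B)) :
    \sum_(p <- r) p.1 *: vec (seqp g (seqp p.2 h)) =
    \sum_(p <- [seq (p.1, seqp g (seqp p.2 h)) | p <- r]) p.1 *: vec p.2.
  by rewrite big_map.
rewrite !E; apply/vec_eqP => u; rewrite !big_map /=.
pose u' : sdiagram A B := Diagram (seqp (par h (idp _)) (dpre u))
                                  (seqp (dpost u) (par g (idp _))).
have uE f : dapp u (seqp g (seqp f h)) = dapp u' f.
  rewrite /dapp /= -{1}[idp (anc u)]comp1p par_comp.
  by rewrite -{2}[idp (anc u)]comp1p par_comp !seqpA.
under eq_bigr do rewrite uE.
by under [RHS]eq_bigr do rewrite uE.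
Qed.

Lemma castp_comp (T : smcat) (A A' B B' C C' : T) (eA : A = A') (eB : B = B')
    (eC : C = C') (g : proc B C) (f : proc A B) :
  castp eA eC (seqp g f) = seqp (castp eB eC g) (castp eA eB f).
Proof. by case: A' / eA; case: B' / eB; case: C' / eC. Qed.

Lemma castp_id (T : smcat) (A A' : T) (e : A = A') :
  castp e e (idp A) = idp A'.
Proof. by case: A' / e. Qed.

Lemma castp_sandwich (T : smcat) (A B : T) (e : A = B) (f : proc A A) :
  seqp (castp (esym e) erefl (idp B)) (seqp f (castp erefl (esym e) (idp B))) =
  castp e e f.
Proof. by case: B / e; rewrite comp1p compp1. Qed.

Lemma castp_trans (T : smcat) (A A' A'' B B' B'' : T) (eA : A = A')
    (eB : B = B') (eA' : A' = A'') (eB' : B' = B'') (f : proc A B) :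
  castp eA' eB' (castp eA eB f) = castp (etrans eA eA') (etrans eB eB') f.
Proof. by case: A'' / eA'; case: B'' / eB'. Qed.

Lemma castp_parl (T : smcat) (A A' B B' C D : T) (eA : A = A') (eB : B = B')
    (f : proc A B) (g : proc C D) :
  par (castp eA eB f) g =
  castp (congr1 (fun X => tens X C) eA) (congr1 (fun X => tens X D) eB)
        (par f g).
Proof. by case: A' / eA; case: B' / eB. Qed.

Lemma tens_st_l (T : smcat) (A B : T) (rho : St A) (sigma : St B) :
  tens_st rho sigma =
  seqp (castp (tens1s B) erefl (par rho (idp B))) sigma.
Proof.
rewrite /tens_st par_lr (castp_comp _ (tens1s B) erefl).
by rewrite par1p.
Qed.

Lemma tens_st_r (T : smcat) (A B : T) (rho : St A) (sigma : St B) :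
  tens_st rho sigma =
  seqp (castp (tenss1 A) erefl (par (idp A) sigma)) rho.
Proof.
rewrite /tens_st par_rl (castp_comp _ (tenss1 A) erefl).
by rewrite (Prop_irrelevance (tens1s triv) (tenss1 triv)) parp1.
Qed.

Lemma lext2E (R : realType) (T : preopt R) (A B C D : T) (W : lmodType R)
    (phi : proc A B -> proc C D -> W)
    (ext := fun x y => lext (fun f => lext (phi f) y) x) :
  (forall f, vec_compat (phi f)) -> (forall g, vec_compat (phi ^~ g)) ->
  [/\ forall y, linear (ext ^~ y), forall x, linear (ext x)
    & forall f g, ext (vec f) (vec g) = phi f g].
Proof.
move=> phil phir.
have compat y : vec_compat (fun f => lext (phi f) y).
  move=> s t st; rewrite /lext.
  under eq_bigr do rewrite scaler_sumr.
  under [RHS]eq_bigr do rewrite scaler_sumr.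
  rewrite exchange_big [RHS]exchange_big /=; apply: eq_bigr => q _.
  under eq_bigr do rewrite scalerA mulrC -scalerA.
  under [RHS]eq_bigr do rewrite scalerA mulrC -scalerA.
  by rewrite -!scaler_sumr (phir q.2 s t st).
split=> [y|x a y z|f g]; first by case: (lextE (compat y)).
  rewrite /ext /lext scaler_sumr -big_split /=; apply: eq_bigr => p _.
  have [lin _] := lextE (phil p.2).
  by rewrite -/(lext _ _) lin scalerDr !scalerA mulrC.
rewrite /ext; have [_ ->] := lextE (compat (vec g)).
by have [_ ->] := lextE (phil f).
Qed.

Lemma scal_vec_compat (R : realType) (T : preopt R) (A B : T)
    (phi : proc A B -> Scal T) :
  vec_compat (fun f => vec (phi f)) ->
  vec_compat (fun f => scal (phi f) : R^o).
Proof.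
move=> phiP s t /phiP st.
have E (r : seq (R * proc A B)) : \sum_(p <- r) p.1 *: vec (phi p.2) =
    \sum_(p <- [seq (p.1, phi p.2) | p <- r]) p.1 *: vec p.2.
  by rewrite big_map.
move: st; rewrite !E => /vec_eqP st.
pose u : diagram (@triv T) triv triv triv :=
  Diagram (castp erefl (esym (tens1s triv)) (idp triv))
          (castp (esym (tens1s triv)) erefl (idp triv)).
have uE (f : Scal T) : dapp u f = f.
  by rewrite /dapp /= castp_sandwich (Prop_irrelevance (tens1s _) (tenss1 _)) parp1.
have := st u; rewrite !big_map /=.
under eq_bigr do rewrite uE.
by under [X in _ = X -> _]eq_bigr do rewrite uE.
Qed.

Lemma pairingE (R : realType) (T : preopt R) (A : T) :
  [/\ forall x, linear (fun e : V A triv => pairing e x : R^o),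
      forall e, linear (fun x : V triv A => pairing e x : R^o)
    & forall (e : Eff A) (rho : St A),
        pairing (vec e) (vec rho) = scal (seqp e rho)].
Proof.
apply: (@lext2E R T A triv triv A R^o (fun e rho => scal (seqp e rho) : R^o)).
  move=> e; apply: scal_vec_compat => s t st.
  have := vec_sandwich e (idp triv) st.
  under eq_bigr do rewrite compp1.
  by under [X in _ = X -> _]eq_bigr do rewrite compp1.
move=> rho; apply: scal_vec_compat => s t st.
have := vec_sandwich (idp triv) rho st.
under eq_bigr do rewrite comp1p.
by under [X in _ = X -> _]eq_bigr do rewrite comp1p.
Qed.

Lemma vtensE (R : realType) (T : preopt R) (A B : T) :
  [/\ forall y : V triv B, linear (fun x : V triv A => vtens x y),
      forall x : V triv A, linear (fun y : V triv B => vtens x y)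
    & forall (rho : St A) (sigma : St B),
        vtens (vec rho) (vec sigma) = vec (tens_st rho sigma)].
Proof.
apply: (@lext2E R T triv A triv B _ (fun rho sigma => vec (tens_st rho sigma))).
  move=> rho s t st.
  have := vec_sandwich (castp (tens1s B) erefl (par rho (idp B))) (idp _) st.
  under eq_bigr do rewrite compp1 -tens_st_l.
  by under [X in _ = X -> _]eq_bigr do rewrite compp1 -tens_st_l.
move=> sigma s t st.
have := vec_sandwich (castp (tenss1 A) erefl (par (idp A) sigma)) (idp _) st.
under eq_bigr do rewrite compp1 -tens_st_r.
by under [X in _ = X -> _]eq_bigr do rewrite compp1 -tens_st_r.
Qed.

Lemma smulp_par (T : smcat) (A B C D : T) (a : Scal T) (f : proc A B)
    (g : proc C D) : par (smulp a f) g = smulp a (par f g).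
Proof.
rewrite /smulp castp_parl -parA castp_trans.
by congr (castp _ _ _); exact: Prop_irrelevance.
Qed.

Lemma smulp_compl (T : smcat) (A B C : T) (a : Scal T) (g : proc B C)
    (f : proc A B) : seqp g (smulp a f) = smulp a (seqp g f).
Proof.
by rewrite /smulp -[a in RHS]comp1p par_comp (castp_comp _ (tens1s B)) par1p.
Qed.

Lemma smulp_compr (T : smcat) (A B C : T) (a : Scal T) (g : proc B C)
    (f : proc A B) : seqp (smulp a g) f = smulp a (seqp g f).
Proof.
by rewrite /smulp -[a in RHS]compp1 par_comp (castp_comp _ (tens1s B)) par1p.
Qed.

Lemma smulp_scal (T : smcat) (a b : Scal T) : smulp a b = seqp a b.
Proof.
rewrite -{1}[b]comp1p -smulp_compr; congr seqp.
rewrite /smulp -[RHS](parp1 a).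
by congr (castp _ _ _); exact: Prop_irrelevance.
Qed.

Lemma vec_smulp (R : realType) (T : preopt R) (A B : T) (a : Scal T)
    (f : proc A B) : vec (smulp a f) = scal a *: vec f.
Proof.
apply: val_inj; apply/funext => u /=.
rewrite /evp /dapp smulp_par smulp_compr smulp_compl smulp_scal scal_comp.
by [].
Qed.

Lemma vec_add (R : realType) (T : preopt R) (A B : T) (f1 f2 : proc A B) :
  exists f : proc A B, vec f = vec f1 + vec f2.
Proof.
have [a1 [g1 [g1F ->]]] := proc_feasible f1.
have [a2 [g2 [g2F ->]]] := proc_feasible f2.
have scal_ge0 (a : Scal T) : 0 <= scal a.
  by have : range (@scal R T) (scal a) by []; rewrite scal_range.
have := scal_ge0 a1; rewrite le_eqVlt => /predU1P[a10|a1_gt0].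
  by exists (smulp a2 g2); rewrite !vec_smulp -a10 scale0r add0r.
set s := scal a1 + scal a2.
have s_gt0 : 0 < s by rewrite ltr_wpDr.
have [c _ cE] : range (@scal R T) s by rewrite scal_range /= ltW.
have [|h [_ hE]] := @proc_convex _ T _ _ g1 g2 (scal a1 / s) g1F g2F.
  by apply/andP; split; [rewrite divr_ge0 // ltW|rewrite ler_pdivrMr // mul1r lerDl].
exists (smulp c h); rewrite !vec_smulp cE.
apply: val_inj; apply/funext => u.
transitivity (s * scal (dapp u h)) => //.
transitivity (scal a1 * scal (dapp u g1) + scal a2 * scal (dapp u g2)) => //.
rewrite hE mulrDr !mulrA; congr (_ * _ + _ * _).
  by rewrite mulrAC divff ?mul1r ?gt_eqF.
by rewrite mulrBr mulr1 mulrA mulrAC divff ?gt_eqF // mul1r /s addrC addKr.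
Qed.

Definition addp (R : realType) (T : preopt R) (A B : T) (f1 f2 : proc A B) :
  proc A B := projT1 (cid (vec_add f1 f2)).

Lemma vec_addp (R : realType) (T : preopt R) (A B : T) (f1 f2 : proc A B) :
  vec (addp f1 f2) = vec f1 + vec f2.
Proof. by rewrite /addp; case: cid. Qed.

Lemma scal_dapp_addp (R : realType) (T : preopt R) (A B : T)
    (f1 f2 : proc A B) (u : sdiagram A B) :
  scal (dapp u (addp f1 f2)) = scal (dapp u f1) + scal (dapp u f2).
Proof. exact: (congr1 (fun x : V A B => V_fun x u) (vec_addp f1 f2)). Qed.

(* Closedness of the set of normalized states is for the Euclidean topology of
   the finite-dimensional space [V triv A], read in linear coordinates. *)
Record opt (R : realType) := Opt {
  opt_po :> preopt R;
  V_findim : forall A B : opt_po,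
    exists (n : nat) (phi : {linear V A B -> 'rV[R]_n}), bijective phi;
  stN_closed : forall (A : opt_po) (n : nat)
      (phi : {linear V triv A -> 'rV[R]_n}), bijective phi ->
    closed [set phi (vec rho) | rho in
             [set rho : St A | scal (seqp (top A) rho) = 1]]
}.

Definition local_equality (R : realType) (T : opt R) : Prop :=
  forall (A B : T) (f f' : proc A B),
    (forall (rho : St A) (e : Eff B),
       seqp e (seqp f rho) = seqp e (seqp f' rho)) -> f = f'.

Definition inner_product (R : realType) (W : lmodType R) (ip : W -> W -> R) :
    Prop :=
  [/\ forall x y, ip x y = ip y x,
      forall a x y z, ip (a *: x + y) z = a * ip x z + ip y z
    & forall x, x != 0 -> 0 < ip x x].

Definition self_dual (R : realType) (W : lmodType R) (C : set W) : Prop :=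
  exists ip : W -> W -> R, inner_product ip /\
    C = [set x | forall y, C y -> 0 <= ip x y].

Definition interior_point (R : realType) (W : lmodType R) (C : set W) (x : W) :
    Prop :=
  C x /\ forall y, C y -> exists delta : R, 0 < delta /\ C (x - delta *: y).

Definition homogeneous_cone (R : realType) (W : lmodType R) (C : set W) :
    Prop :=
  forall x y, interior_point C x -> interior_point C y ->
    exists phi : {linear W -> W}, [/\ bijective phi, phi @` C = C & phi x = y].

Definition symmetric_cone (R : realType) (W : lmodType R) (C : set W) : Prop :=
  self_dual C /\ homogeneous_cone C.

Definition diamond (R : realType) (T : opt R) : Prop :=
  forall A : T,
    symmetric_cone (range (@vec R T triv A)) /\
    range (@vec R T A triv) =
      [set e | forall rho : St A, 0 <= pairing e (vec rho)].

Definition psd (R : realType) (n : nat) (X : 'M[R[i]]_n) : Prop :=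
  X \is hermsymmx /\
  forall v : 'cV[R[i]]_n, 0 <= (v ^t* *m X *m v) 0 0.

(* A direct sum decomposition of [C^N], [N] being the sum of the [n_i], given by
   mutually orthogonal (Hermitian) projections of ranks [n_i]. *)
Record projfam (R : realType) := ProjFam {
  pf_k : nat;
  pf_n : 'I_pf_k -> nat;
  pf_N := (\sum_i pf_n i)%N;
  pf_P : 'I_pf_k -> 'M[R[i]]_pf_N;
  pf_gt0 : forall i, (0 < pf_n i)%N;
  pf_herm : forall i, pf_P i \is hermsymmx;
  pf_idem : forall i, pf_P i *m pf_P i = pf_P i;
  pf_orth : forall i j, i != j -> pf_P i *m pf_P j = 0;
  pf_rank : forall i, \rank (pf_P i) = pf_n i
}.

Definition in_blkmx (R : realType) (Q : projfam R) : {pred 'M[R[i]]_(pf_N Q)} :=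
  fun X => `[< exists H : 'I_(pf_k Q) -> 'M[R[i]]_(pf_N Q),
    (forall i, H i \is hermsymmx /\ pf_P i *m H i *m pf_P i = H i) /\
    X = \sum_i H i >].

Lemma hermmxP (R : realType) (n : nat) (X : 'M[R[i]]_n) :
  X \is hermsymmx <-> X ^t* = X.
Proof.
by rewrite is_hermitianmxE expr0 scale1r; split=> [/eqP <-|/eqP]; rewrite // eq_sym.
Qed.

Lemma herm_real_comb (R : realType) (n : nat) (a : R) (X Y : 'M[R[i]]_n) :
  X \is hermsymmx -> Y \is hermsymmx -> a%:C *: X + Y \is hermsymmx.
Proof.
move=> /hermmxP XE /hermmxP YE; apply/hermmxP.
rewrite -[in RHS]XE -[in RHS]YE; apply/matrixP => i j.
rewrite !mxE rmorphD rmorphM /=; congr (_ * _ + _).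
by apply/CrealP; rewrite complex_real.
Qed.

Lemma blkmx_comb (R : realType) (Q : projfam R) (a : R) (X Y : 'M[R[i]]_(pf_N Q)) :
  X \in @in_blkmx R Q -> Y \in @in_blkmx R Q ->
  a%:C *: X + Y \in @in_blkmx R Q.
Proof.
move=> /asboolP[H [HP ->]] /asboolP[K [KP ->]]; apply/asboolP.
exists (fun i => a%:C *: H i + K i); split=> [i|]; last first.
  by rewrite big_split scaler_sumr.
have [Hh HE] := HP i; have [Kh KE] := KP i; split; first exact: herm_real_comb.
by rewrite mulmxDr mulmxDl -scalemxAr -scalemxAl HE KE.
Qed.

Lemma blkmx_zmod_closed (R : realType) (Q : projfam R) :
  zmod_closed (@in_blkmx R Q).
Proof.
have in0 : 0 \in @in_blkmx R Q.
  apply/asboolP; exists (fun=> 0); split=> [i|]; last by rewrite big1.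
  split; last by rewrite mulmx0 mul0mx.
  by apply/hermmxP/matrixP => j k; rewrite !mxE rmorph0.
split=> // X Y XP YP; rewrite addrC -scaleN1r.
suff -> : -1 = (- 1 : R)%:C by exact: blkmx_comb.
by rewrite rmorphN rmorph1.
Qed.

HB.instance Definition _ (R : realType) (Q : projfam R) :=
  GRing.isZmodClosed.Build 'M[R[i]]_(pf_N Q) (@in_blkmx R Q)
    (@blkmx_zmod_closed R Q).

(* The real vector space [M_A], a subset of the complex matrices. *)
Record blkmx (R : realType) (Q : projfam R) := BlkMx {
  blk_val :> 'M[R[i]]_(pf_N Q);
  blk_valP : blk_val \in @in_blkmx R Q
}.

HB.instance Definition _ (R : realType) (Q : projfam R) :=
  [isSub for @blk_val R Q].
HB.instance Definition _ (R : realType) (Q : projfam R) :=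
  [Choice of blkmx Q by <:].
HB.instance Definition _ (R : realType) (Q : projfam R) :=
  [SubChoice_isSubZmodule of blkmx Q by <:].

Lemma blkmx_scale_subproof (R : realType) (Q : projfam R) (a : R)
    (X : blkmx Q) : a%:C *: blk_val X \in @in_blkmx R Q.
Proof.
have [in0 _] := blkmx_zmod_closed Q.
by rewrite -[_ *: _]addr0; apply: blkmx_comb => //; exact: blk_valP.
Qed.

Definition blkmx_scale (R : realType) (Q : projfam R) (a : R) (X : blkmx Q) :
  blkmx Q := BlkMx (blkmx_scale_subproof a X).

Lemma blkmx_scalerA (R : realType) (Q : projfam R) (a b : R) (X : blkmx Q) :
  blkmx_scale a (blkmx_scale b X) = blkmx_scale (a * b) X.
Proof. by apply: val_inj; rewrite /= scalerA rmorphM. Qed.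

Lemma blkmx_scale1r (R : realType) (Q : projfam R) :
  left_id 1 (@blkmx_scale R Q).
Proof. by move=> X; apply: val_inj; rewrite /= scale1r. Qed.

Lemma blkmx_scalerDr (R : realType) (Q : projfam R) :
  right_distributive (@blkmx_scale R Q) +%R.
Proof. by move=> a X Y; apply: val_inj; rewrite /= scalerDr. Qed.

Lemma blkmx_scalerDl (R : realType) (Q : projfam R) (X : blkmx Q) :
  {morph (@blkmx_scale R Q)^~ X : a b / a + b}.
Proof. by move=> a b; apply: val_inj; rewrite /= rmorphD scalerDl. Qed.

HB.instance Definition _ (R : realType) (Q : projfam R) :=
  GRing.Zmodule_isLmodule.Build R (blkmx Q) (@blkmx_scalerA R Q)
    (@blkmx_scale1r R Q) (@blkmx_scalerDr R Q) (@blkmx_scalerDl R Q).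

(* [*t] is the Kronecker product; [mr_N], implicit in the last two equations,
   makes them well-typed. *)
Record matrep (R : realType) (T : opt R) := MatRep {
  mr_P : T -> projfam R;
  mr_M : forall A : T, {linear V triv A -> blkmx (mr_P A)};
  mr_bij : forall A, bijective (mr_M A);
  mr_St : forall A,
    mr_M A @` range (@vec R T triv A) = [set X | psd (blk_val X)];
  mr_tr : forall A (x : V triv A),
    \tr (blk_val (mr_M A x)) = (pairing (vec (top A)) x)%:C;
  mr_N : forall A B,
    pf_N (mr_P (tens A B)) = (pf_N (mr_P A) * pf_N (mr_P B))%N;
  mr_P_tens : forall A B,
    [set castmx (mr_N A B, mr_N A B) (pf_P l) | l in
      [set: 'I_(pf_k (mr_P (tens A B)))]] =
    [set X | exists (i : 'I_(pf_k (mr_P A))) (j : 'I_(pf_k (mr_P B))),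
       X = pf_P i *t pf_P j];
  mr_M_tens : forall A B (x : V triv A) (y : V triv B),
    castmx (mr_N A B, mr_N A B) (blk_val (mr_M (tens A B) (vtens x y))) =
    blk_val (mr_M A x) *t blk_val (mr_M B y)
}.

(* [L] is completely positive if [L (x) id], from [M_A (x) S(C^d)] to
   [M_B (x) S(C^d)], preserves positive semidefiniteness for every [d]; the
   elements of these real tensor products are the sums [sum_k X_k (x) Y_k]. *)
Definition CP (R : realType) (Q Q' : projfam R) : set (blkmx Q -> blkmx Q') :=
  [set L | linear L /\
    forall (d : nat) (s : seq (blkmx Q * 'M[R[i]]_d)),
      all (fun p => p.2 \is hermsymmx) s ->
      psd (\sum_(p <- s) blk_val p.1 *t p.2) ->
      psd (\sum_(p <- s) blk_val (L p.1) *t p.2)].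

Arguments CP {R} Q Q'.

(* The cone structure on processes is given by [addp] and by scaling with the
   scalars, which are the nonnegative reals through [scal]. *)
Definition cone_iso (R : realType) (T : opt R) (A B : T) (W : lmodType R)
    (K : set W) (L : proc A B -> W) : Prop :=
  [/\ injective L, range L = K,
      forall f g, L (addp f g) = L f + L g
    & forall (a : Scal T) f, L (smulp a f) = scal a *: L f].

(* Main.v *)
From HB Require Import structures.
Require Import Defs.
From mathcomp Require Import all_boot all_order all_algebra.
From mathcomp Require Import mxtens complex.
From mathcomp Require Import all_classical all_reals all_analysis.

(* Choose dual bases [b_k], [c_k] of [M_A] for the trace form, so that
   [X = sum_k tr (c_k X) b_k], and a transpose [tau] preserving [M_A].  Then
   [Phi = sum_k b_k (x) tau c_k] is a maximally entangled positive element of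
   [M_(A (x) A)]: it is a state [eta], and by self-duality also an effect [eps].
   Applying [f (x) id_A] to [eta] shows that the Choi matrix of the map induced
   by a process [f] is positive, hence the map is completely positive.
   Conversely, the Choi matrix of a completely positive map is a state of
   [B (x) A], and teleporting the input through it by means of [eps] gives a
   process inducing the map.  Local equality yields injectivity. *)

Set Implicit Arguments.
Unset Strict Implicit.
Unset Printing Implicit Defensive.

Import Order.TTheory GRing.Theory Num.Theory.
Local Open Scope classical_set_scope.
Local Open Scope ring_scope.
Local Open Scope sesquilinear_scope.
Local Open Scope complex_scope.

(** * Positive semidefinite matrices and Kraus operators *)

Lemma trmxC_mul (C : numClosedFieldType) m n p (A : 'M[C]_(m, n))
    (B : 'M[C]_(n, p)) : (A *m B)^t* = B^t* *m A^t*.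
Proof. by rewrite trmx_mul map_mxM. Qed.

Lemma trmxC_tens (C : numClosedFieldType) m n p q (A : 'M[C]_(m, n))
    (B : 'M[C]_(p, q)) : (A *t B)^t* = A^t* *t B^t*.
Proof. by rewrite trmx_tens map_mxT. Qed.

Lemma psdD (R : realType) n (X Y : 'M[R[i]]_n) : psd X -> psd Y -> psd (X + Y).
Proof.
move=> [/hermmxP hX pX] [/hermmxP hY pY]; split=> [|v].
  by apply/hermmxP; rewrite raddfD /= map_mxD hX hY.
by rewrite mulmxDr mulmxDl mxE addr_ge0.
Qed.

Lemma psd0 (R : realType) n : psd (0 : 'M[R[i]]_n).
Proof.
split=> [|v]; first by apply/hermmxP; rewrite trmx0 map_mx0.
by rewrite mulmx0 mul0mx mxE.
Qed.

Lemma psd_sum (R : realType) n (I : Type) (s : seq I) (F : I -> 'M[R[i]]_n) :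
  (forall i, psd (F i)) -> psd (\sum_(i <- s) F i).
Proof. by move=> FP; apply: (big_ind (@psd R n) (psd0 R n) (@psdD R n)) => k _. Qed.

Lemma psd_congr (R : realType) m n (G : 'M[R[i]]_(m, n)) (X : 'M[R[i]]_n) :
  psd X -> psd (G *m X *m G^t*).
Proof.
move=> [/hermmxP hX pX]; split=> [|v].
  by apply/hermmxP; rewrite !trmxC_mul hX trmxCK mulmxA.
by have := pX (G^t* *m v); rewrite trmxC_mul trmxCK !mulmxA.
Qed.

Lemma psd1 (R : realType) n : psd (1%:M : 'M[R[i]]_n).
Proof.
split=> [|v]; first by apply/hermmxP; rewrite trmx1 map_mx1.
rewrite mulmx1 mxE sumr_ge0 // => i _.
by rewrite !mxE mulrC mul_conjC_ge0.
Qed.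

Lemma psd_gram (R : realType) m n (G : 'M[R[i]]_(m, n)) : psd (G *m G^t*).
Proof. by have := psd_congr G (psd1 R n); rewrite mulmx1. Qed.

Lemma psd_castmx (R : realType) m n (e e' : m = n) (X : 'M[R[i]]_m) :
  psd (castmx (e, e') X) <-> psd X.
Proof. by case: n / e e' => e'; rewrite castmx_id. Qed.

Lemma psd_diag_ge0 (R : realType) n (X : 'M[R[i]]_n) (k : 'I_n) :
  psd X -> 0 <= X k k.
Proof.
move=> [_ /(_ (delta_mx k 0))].
rewrite trmx_delta map_delta_mx -rowE !mxE (bigD1 k) //= big1 ?addr0.
  by rewrite !mxE !eqxx mulr1.
by move=> j jk; rewrite !mxE (negPf jk) mulr0.
Qed.

Lemma herm_spectral (C : numClosedFieldType) n (X : 'M[C]_n) : X \is hermsymmx ->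
  exists (S : 'M[C]_n) (d : 'rV[C]_n),
    S *m S^t* = 1%:M /\ X = S^t* *m diag_mx d *m S.
Proof.
move=> /hermitian_normalmx/orthomx_spectralP XE.
exists (spectralmx X), (spectral_diag X).
have U := spectral_unitarymx X; split; first exact/unitarymxP.
by rewrite {1}XE invmx_unitary.
Qed.

(** Diagonalize [X] by a unitary [S]. The eigenvalues are the diagonal entries of [S X S^t*], hence
    nonnegative, and [G] is [S^t*] times the diagonal matrix of their square roots. *)
Lemma psd_factor (R : realType) n (X : 'M[R[i]]_n) :
  psd X -> exists G : 'M[R[i]]_n, X = G *m G^t*.
Proof.
move=> Xpsd; have [S [d [SS XE]]] := herm_spectral (proj1 Xpsd).
have d_ge0 k : 0 <= d 0 k.
  have := psd_diag_ge0 k (psd_congr S Xpsd).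
  by rewrite XE -!mulmxA SS mulmx1 !mulmxA SS mul1mx mxE eqxx.
exists (S^t* *m diag_mx (map_mx sqrtC d)).
rewrite trmxC_mul trmxCK mulmxA XE; congr (_ *m S); rewrite -mulmxA; congr (_ *m _).
rewrite tr_diag_mx map_diag_mx mulmx_diag; congr diag_mx.
apply/rowP => k; rewrite !mxE /=.
by rewrite geC0_conj ?sqrtC_ge0 // -expr2 sqrtCK.
Qed.

(** With [Y = G G^t*], cyclicity turns the trace into that of the congruence [G^t* X G], whose
    diagonal is nonnegative. *)
Lemma psd_trM_ge0 (R : realType) n (X Y : 'M[R[i]]_n) :
  psd X -> psd Y -> 0 <= \tr (X *m Y).
Proof.
move=> Xpsd /psd_factor[G ->]; rewrite mulmxA mxtrace_mulC mulmxA.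
rewrite sumr_ge0 // => k _; apply: psd_diag_ge0.
by have := psd_congr (G^t*) Xpsd; rewrite trmxCK.
Qed.

Lemma tr_tens (K : comPzRingType) m n (A : 'M[K]_m) (B : 'M[K]_n) :
  \tr (A *t B) = \tr A * \tr B.
Proof.
rewrite /mxtrace mulr_sum; apply: eq_bigr => k _; exact: mxE.
Qed.

(* The matrix [sum_k B_k (x) C_k^T] is the Choi matrix of the map
   [X |-> sum_k tr (C_k X) B_k]; a square root of it yields Kraus operators. *)
Lemma kraus_of_choi (R : realType) m n l (B : 'I_l -> 'M[R[i]]_m)
    (C : 'I_l -> 'M[R[i]]_n) :
  psd (\sum_k B k *t (C k)^T) ->
  exists W : 'I_(m * n) -> 'M[R[i]]_(m, n), forall X : 'M[R[i]]_n,
    \sum_k \tr (C k *m X) *: B k = \sum_j W j *m X *m (W j)^t*.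
Proof.
move=> /psd_factor[G GE].
(* The columns of the square root [G], reshaped into [m] by [n] matrices, are the Kraus operators;
   [E] is the equation [X = G G^t*] for the Choi matrix, read entrywise. *)
exists (fun j => \matrix_(x, a) G (mxtens_index (x, a)) j) => X.
have E x y a b : \sum_k B k x y * C k b a =
    \sum_j G (mxtens_index (x, a)) j * Num.conj (G (mxtens_index (y, b)) j).
  have /matrixP/(_ (mxtens_index (x, a)) (mxtens_index (y, b))) := GE.
  rewrite summxE mxE; under eq_bigr do rewrite tensmxE mxE.
  by move=> ->; apply: eq_bigr => j _; rewrite !mxE.
apply/matrixP => x y; rewrite !summxE.
transitivity (\sum_a \sum_b X a b * \sum_k B k x y * C k b a).
  under [RHS]eq_bigr do under eq_bigr do rewrite mulr_sumr.
  under [RHS]eq_bigr do rewrite exchange_big.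
  rewrite exchange_big; apply: eq_bigr => k _ /=.
  rewrite mxE /mxtrace mulr_suml exchange_big /=; apply: eq_bigr => b _.
  rewrite mxE mulr_suml; apply: eq_bigr => a _.
  by rewrite mulrC mulrCA [C k _ _ * _]mulrC -mulrA mulrC -!mulrA; congr (_ * _); rewrite mulrC.
under eq_bigr do under eq_bigr do rewrite E mulr_sumr.
under eq_bigr do rewrite exchange_big.
rewrite exchange_big; apply: eq_bigr => j _ /=.
rewrite mxE exchange_big /=; apply: eq_bigr => b _.
rewrite !mxE mulr_suml; apply: eq_bigr => a _; rewrite !mxE.
by rewrite mulrA [X a b * _]mulrC.
Qed.

(** * Block matrices and pinching *)

Lemma blk_herm (R : realType) (Q : projfam R) (X : blkmx Q) :
  (blk_val X)^t* = blk_val X.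
Proof.
case: X => X /=; set p := in_mem _ _ => XP.
have /asboolP[H [HP ->]] : X \in @in_blkmx R Q by exact: XP.
rewrite raddf_sum map_mx_sum; apply: eq_bigr => k _.
by have [/hermmxP] := HP k.
Qed.

(** The pinching map. On Hermitian matrices it is the orthogonal projection onto [blkmx Q] for the
    trace form, by [pinch_in_blkmx], [blk_pinch] and [tr_blk_pinch]. *)
Definition pinch (R : realType) (Q : projfam R) (X : 'M[R[i]]_(pf_N Q)) :
  'M[R[i]]_(pf_N Q) := \sum_k pf_P k *m X *m pf_P k.

Lemma blk_offdiag (R : realType) (Q : projfam R) (X : blkmx Q)
    (k l : 'I_(pf_k Q)) : k != l -> pf_P k *m blk_val X *m pf_P l = 0.
Proof.
case: X => X /= XP kl.
have /asboolP[H [HP ->]] : X \in @in_blkmx R Q by exact: XP.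
rewrite mulmx_sumr mulmx_suml big1 // => j _.
have [_ <-] := HP j; rewrite !mulmxA.
have [<-|kj] := eqVneq k j; last by rewrite pf_orth // !mul0mx.
by rewrite -!mulmxA pf_orth // !mulmx0.
Qed.

Lemma blk_pinch (R : realType) (Q : projfam R) (X : blkmx Q) :
  pinch (blk_val X) = blk_val X.
Proof.
case: X => X /= XP.
have /asboolP[H [HP ->]] : X \in @in_blkmx R Q by exact: XP.
rewrite /pinch; apply: eq_bigr => k _.
rewrite mulmx_sumr mulmx_suml (bigD1 k) //= big1 ?addr0; first by have [] := HP k.
move=> j jk; have [_ <-] := HP j.
by rewrite !mulmxA pf_orth 1?eq_sym // !mul0mx.
Qed.

Lemma pinch_in_blkmx (R : realType) (Q : projfam R) (X : 'M[R[i]]_(pf_N Q)) :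
  X \is hermsymmx -> pinch X \in @in_blkmx R Q.
Proof.
move=> /hermmxP Xh; apply/asboolP; exists (fun k => pf_P k *m X *m pf_P k).
split=> // k; split; last by rewrite !mulmxA pf_idem -!mulmxA pf_idem.
have /hermmxP Ph := pf_herm k.
by apply/hermmxP; rewrite !trmxC_mul Ph Xh mulmxA.
Qed.

Lemma pinch_sum_mul (R : realType) (Q : projfam R) (X : 'M[R[i]]_(pf_N Q)) :
  (\sum_k pf_P k) *m pinch X = pinch X.
Proof.
rewrite mulmx_sumr; apply: eq_bigr => k _; rewrite mulmx_suml (bigD1 k) //=.
rewrite big1 ?addr0 => [|j jk]; first by rewrite !mulmxA pf_idem.
by rewrite !mulmxA pf_orth // !mul0mx.
Qed.

Lemma pinch_mul_sum (R : realType) (Q : projfam R) (X : 'M[R[i]]_(pf_N Q)) :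
  pinch X *m (\sum_k pf_P k) = pinch X.
Proof.
rewrite mulmx_suml; apply: eq_bigr => k _; rewrite mulmx_sumr (bigD1 k) //=.
rewrite big1 ?addr0 => [|j jk]; first by rewrite -!mulmxA pf_idem.
by rewrite -!mulmxA pf_orth 1?eq_sym // !mulmx0.
Qed.

(** Pinching is self-adjoint for the trace form, by cyclicity of the trace, and it fixes [Y]. *)
Lemma tr_blk_pinch (R : realType) (Q : projfam R) (Y : blkmx Q)
    (X : 'M[R[i]]_(pf_N Q)) :
  \tr (blk_val Y *m pinch X) = \tr (blk_val Y *m X).
Proof.
rewrite -[in RHS]blk_pinch mulmx_sumr mulmx_suml !raddf_sum /=.
apply: eq_bigr => k _.
by rewrite mulmxA mxtrace_mulC !mulmxA.
Qed.

(** * The trace form and dual bases *)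

Definition trf (R : realType) (Q : projfam R) (X Y : blkmx Q) : R :=
  complex.Re (\tr (blk_val X *m blk_val Y)).

(** The trace of a product of two Hermitian matrices equals its own conjugate, so taking the real
    part in [trf] loses nothing. *)
Lemma trfE (R : realType) (Q : projfam R) (X Y : blkmx Q) :
  (trf X Y)%:C = \tr (blk_val X *m blk_val Y).
Proof.
apply: RRe_real; apply/CrealP; rewrite -trace_map_mx -mxtrace_tr map_trmx.
by rewrite trmxC_mul !blk_herm mxtrace_mulC.
Qed.

Lemma trfC (R : realType) (Q : projfam R) (X Y : blkmx Q) : trf X Y = trf Y X.
Proof. by rewrite /trf mxtrace_mulC. Qed.

Lemma trf_linear (R : realType) (Q : projfam R) (X : blkmx Q) :
  linear (trf X : blkmx Q -> R^o).
Proof.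
move=> a Y Z; rewrite /trf.
have -> : blk_val (a *: Y + Z) = a%:C *: blk_val Y + blk_val Z by [].
rewrite mulmxDr -scalemxAr mxtraceD mxtraceZ.
by case: (\tr _) => x y; case: (\tr _) => z t /=; rewrite mul0r subr0.
Qed.

(** As [X] is Hermitian, [trf X X] is the sum of the squared moduli of its entries. *)
Lemma trf_definite (R : realType) (Q : projfam R) (X : blkmx Q) :
  trf X X = 0 -> X = 0.
Proof.
move=> X0; apply: val_inj; rewrite /=; apply/matrixP => k l; rewrite [RHS]mxE.
have : \tr (blk_val X *m (blk_val X)^t*) = 0 by rewrite blk_herm -trfE X0.
have ge0 a b : 0 <= blk_val X a b * Num.conj (blk_val X a b).
  exact: mul_conjC_ge0.
move=> /eqP; rewrite /mxtrace psumr_eq0 => [/allP/(_ k)|a _]; last first.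
  by rewrite mxE sumr_ge0 // => b _; rewrite !mxE.
rewrite mem_index_enum mxE psumr_eq0 => [/(_ isT)/allP/(_ l)|b _]; last first.
  by rewrite !mxE.
by rewrite mem_index_enum !mxE mul_conjC_eq0 => /(_ isT)/eqP.
Qed.

HB.instance Definition _ (R : realType) (Q : projfam R) (X : blkmx Q) :=
  GRing.isLinear.Build R (blkmx Q) R^o *%R (trf X : blkmx Q -> R^o)
    (trf_linear X).

(** Pull the standard basis back along [phi] to get [b]. Its Gram matrix is invertible since the
    form is definite, and the inverse turns [b] into the dual basis [c]. *)
Lemma trf_dual_bases (R : realType) (Q : projfam R) n
    (phi : {linear blkmx Q -> 'rV[R]_n}) : bijective phi ->
  exists b c : 'I_n -> blkmx Q, forall X, X = \sum_k trf (c k) X *: b k.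
Proof.
move=> [psi phiK psiK].
pose b k := psi (delta_mx 0 k).
have bE X : X = \sum_k phi X 0 k *: b k.
  apply: (can_inj phiK); rewrite linear_sum {1}[phi X]row_sum_delta.
  by apply: eq_bigr => k _; rewrite linearZ /= psiK.
pose G := \matrix_(k, l) trf (b k) (b l).
have tE X l : trf (b l) X = (phi X *m G) 0 l.
  rewrite [X in LHS]bE linear_sum mxE; apply: eq_bigr => k _.
  by rewrite linearZ_LR mxE trfC.
have Gunit : G \in unitmx.
  rewrite -row_free_unit; apply/inj_row_free => u uG0.
  suff : psi u = 0 by move=> /(congr1 phi); rewrite psiK linear0.
  apply: trf_definite; rewrite {2}[psi u]bE linear_sum big1 // => l _.
  by rewrite linearZ_LR /= trfC tE psiK uG0 mxE mulr0.
exists b, (fun k => \sum_l invmx G l k *: b l) => X.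
rewrite {1}[X]bE; apply: eq_bigr => k _; congr (_ *: _).
rewrite trfC linear_sum /=.
transitivity ((phi X *m G *m invmx G) 0 k); first by rewrite mulmxK.
rewrite mxE; apply: eq_bigr => l _.
by rewrite -tE linearZ_LR /= trfC mulrC.
Qed.

Lemma blk_val_sum (R : realType) (Q : projfam R) (I : Type) (s : seq I)
    (F : I -> blkmx Q) :
  blk_val (\sum_(k <- s) F k) = \sum_(k <- s) blk_val (F k).
Proof. exact: (big_morph (@blk_val R Q) (fun _ _ => erefl) erefl). Qed.

Lemma eq_linear_herm (R : realType) n (W : lmodType R[i])
    (F G : 'M[R[i]]_n -> W) : linear F -> linear G ->
  (forall X, X \is hermsymmx -> F X = G X) -> F =1 G.
Proof.
move=> Flin Glin FG X.
have eqZD a Y Z : F Y = G Y -> F Z = G Z -> F (a *: Y + Z) = G (a *: Y + Z).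
  by move=> YE ZE; rewrite Flin Glin YE ZE.
have h1 : X + X^t* \is hermsymmx.
  by apply/hermmxP; rewrite raddfD /= map_mxD trmxCK addrC.
have h2 : 'i *: (X - X^t*) \is hermsymmx.
  apply/hermmxP; rewrite linearZ /= map_mxZ raddfB /= map_mxB trmxCK conjCi.
  by rewrite scaleNr -scalerN opprB.
have -> : X = 2^-1 *: (- 'i *: ('i *: (X - X^t*)) + (X + X^t*)) + 0.
  rewrite scalerA mulNr -expr2 sqrCi opprK scale1r addr0 addrACA addNr addr0.
  by rewrite -mulr2n -[X *+ 2]scaler_nat scalerA mulVf ?scale1r // pnatr_eq0.
have E0 : F 0 = G 0 by apply: FG; apply/hermmxP; rewrite trmx0 map_mx0.
exact: eqZD _ _ _ (eqZD _ _ _ (FG _ h2) (FG _ h1)) E0.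
Qed.

(** Both sides are complex linear, so [X] may be taken Hermitian. Then the left side is the
    expansion of the block matrix [pinch X], because [c k] has the same trace against [X] as against
    [pinch X]. *)
Lemma sum_dual_bases_pinch (R : realType) (Q : projfam R) n
    (b c : 'I_n -> blkmx Q) :
  (forall X, X = \sum_k trf (c k) X *: b k) ->
  forall X, \sum_k \tr (blk_val (c k) *m X) *: blk_val (b k) = pinch X.
Proof.
move=> bc; apply: eq_linear_herm => [a X Y|a X Y|X /pinch_in_blkmx Xp].
- rewrite scaler_sumr -big_split; apply: eq_bigr => k _ /=.
  by rewrite mulmxDr -scalemxAr mxtraceD mxtraceZ scalerDl scalerA.
- rewrite scaler_sumr -big_split; apply: eq_bigr => k _ /=.
  by rewrite mulmxDr mulmxDl -scalemxAr -scalemxAl.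
- have := congr1 (@blk_val R Q) (bc (BlkMx Xp)).
  rewrite blk_val_sum /= => ->.
  by apply: eq_bigr => k _; rewrite -tr_blk_pinch -(trfE _ (BlkMx Xp)).
Qed.

(** By [sum_dual_bases_pinch] this is the Choi matrix of the pinching map, whose Kraus operators are
    the projections; so it is the sum of the rank-one matrices built from the vectorized projections
    [p k]. *)
Lemma dual_bases_choi_psd (R : realType) (Q : projfam R) n
    (b c : 'I_n -> blkmx Q) :
  (forall X, X = \sum_k trf (c k) X *: b k) ->
  psd (\sum_k blk_val (b k) *t (blk_val (c k))^T).
Proof.
move=> /sum_dual_bases_pinch bc.
pose p (k : 'I_(pf_k Q)) := \col_i pf_P k (mxtens_unindex i).1 (mxtens_unindex i).2.
suff -> : \sum_k blk_val (b k) *t (blk_val (c k))^T =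
          \sum_(k : 'I_(pf_k Q)) p k *m (p k)^t*.
  by apply: psd_sum => k; exact: psd_gram.
apply/matrixP => i j.
case: (mxtens_indexP i) => x a; case: (mxtens_indexP j) => y d.
rewrite !summxE; under eq_bigr do rewrite tensmxE mxE.
(* At a matrix unit, [\tr (blk_val (c k) *m delta_mx a d)] is the single entry [(d, a)] of [c k]. *)
have /matrixP/(_ x y) := bc (delta_mx a d).
rewrite summxE /pinch summxE => E.
transitivity (\sum_k (\tr (blk_val (c k) *m delta_mx a d) *: blk_val (b k)) x y).
  apply: eq_bigr => k _; rewrite mxE mulrC; congr (_ * _).
  rewrite /mxtrace (bigD1 d) //= mxE (bigD1 a) //= big1 => [|z za]; last first.
    by rewrite mxE (negPf za) mulr0.
  rewrite mxE !eqxx mulr1 addr0 big1 ?addr0 // => z zd.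
  by rewrite mxE big1 // => w _; rewrite mxE (negPf zd) andbF mulr0.
rewrite E; apply: eq_bigr => k _; rewrite [RHS]mxE big_ord1 !mxE !mxtens_indexK /=.
have /hermmxP/matrixP/(_ d y) := pf_herm k; rewrite !mxE => ->.
rewrite (bigD1 d) //= big1 ?addr0 => [|z zd].
  rewrite mxE (bigD1 a) //= big1 ?addr0 => [|w wa].
    by rewrite mxE !eqxx mulr1.
  by rewrite mxE (negPf wa) mulr0.
rewrite mxE big1 ?mul0r // => w _.
by rewrite mxE (negPf zd) andbF mulr0.
Qed.

(** * A transpose that preserves the block matrices *)

Lemma proj_conj_factor (K : numClosedFieldType) n (P : 'M[K]_n) :
  P \is hermsymmx -> P *m P = P ->
  exists C : 'M[K]_n, [/\ C^T = C, P *m C = C & C *m C^t* = P].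
Proof.
move=> Ph PP; have Pc : P^t* = P.
  by apply/esym/eqP; move: Ph; rewrite is_hermitianmxE expr0 scale1r.
have [S [d [SS PE]]] := herm_spectral Ph.
have dE : diag_mx d = S *m P *m S^t*.
  by rewrite PE !mulmxA SS mul1mx -mulmxA SS mulmx1.
have dd : diag_mx d *m diag_mx d = diag_mx d.
  have SS' : S^t* *m S = 1%:M by exact: mulmx1C.
  by rewrite dE !mulmxA -[_ *m S^t* *m S]mulmxA SS' mulmx1 -[S *m P *m P]mulmxA PP.
have dh : (diag_mx d)^t* = diag_mx d.
  by rewrite dE !trmxC_mul trmxCK Pc mulmxA.
have ScS : map_mx Num.conj S *m S^T = 1%:M.
  have := congr1 (map_mx Num.conj) SS.
  by rewrite map_mxM map_mx1 map_mxCK.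
(* Call this matrix [C]. The antilinear map sending [v] to [C] times the conjugate of [v] is complex
   conjugation on the range of [P], in the eigenbasis given by [S], and zero on the orthogonal
   complement. *)
exists (S^t* *m diag_mx d *m map_mx Num.conj S); split.
- by rewrite !trmx_mul tr_diag_mx -map_trmx trmxK mulmxA.
- by rewrite PE -!mulmxA [S *m _]mulmxA SS mul1mx [diag_mx d *m _]mulmxA dd.
rewrite !trmxC_mul trmxCK dh.
have -> : (map_mx Num.conj S)^t* = S^T by rewrite map_trmx map_mxCK.
rewrite !mulmxA -[_ *m map_mx Num.conj S *m S^T]mulmxA ScS mulmx1.
by rewrite -[_ *m diag_mx d *m diag_mx d]mulmxA dd PE.
Qed.

(** Sum the conjugations [Ck k] of the single blocks. A cross term between blocks [k] and [l]
    contains the transpose of [pf_P l *m X *m pf_P k], which vanishes for block matrices and for the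
    identity. *)
Lemma projfam_conj (R : realType) (Q : projfam R) :
  exists C : 'M[R[i]]_(pf_N Q), [/\ C^T = C, C *m C^t* = \sum_k pf_P k &
    forall X : blkmx Q, C *m (blk_val X)^T *m C^t* \in @in_blkmx R Q].
Proof.
have [Ck CkP] := choice (fun k =>
  proj_conj_factor (@pf_herm R Q k) (@pf_idem R Q k)).
have PT k : (pf_P k)^T = map_mx Num.conj (pf_P k) :> 'M[R[i]]_(pf_N Q).
  by have /hermmxP {1}<- := pf_herm k; rewrite map_trmx trmxK.
have CP k : Ck k = Ck k *m (pf_P k)^T.
  by have [CT PC _] := CkP k; rewrite -{2}CT -trmx_mul PC.
have CPs k : (Ck k)^t* = (pf_P k)^T *m (Ck k)^t*.
  by rewrite {1}CP trmxC_mul; congr (_ *m _); rewrite trmxK -PT.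
have offdiag (X : 'M[R[i]]_(pf_N Q)) :
    (forall k l : 'I_(pf_k Q), k != l -> pf_P k *m X *m pf_P l = 0) ->
    (\sum_k Ck k) *m X^T *m (\sum_k Ck k)^t* =
    \sum_k Ck k *m X^T *m (Ck k)^t*.
  move=> X0; rewrite !mulmx_suml; apply: eq_bigr => k _.
  rewrite raddf_sum map_mx_sum mulmx_sumr (bigD1 k) //= big1 ?addr0 // => l lk.
  suff -> : Ck k *m X^T *m (Ck l)^t* =
            Ck k *m (pf_P l *m X *m pf_P k)^T *m (Ck l)^t*.
    by rewrite X0 // trmx0 mulmx0 mul0mx.
  by rewrite {1}CP {1}CPs !trmx_mul !mulmxA.
exists (\sum_k Ck k); split=> [||X].
- by rewrite raddf_sum; apply: eq_bigr => k _; have [] := CkP k.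
- have := offdiag 1%:M; rewrite trmx1 mulmx1 => -> => [|k l kl].
    by apply: eq_bigr => k _; rewrite mulmx1; have [] := CkP k.
  by rewrite mulmx1 pf_orth.
rewrite offdiag => [|k l]; last exact: blk_offdiag.
apply/asboolP; exists (fun k => Ck k *m (blk_val X)^T *m (Ck k)^t*).
split=> // k; split.
  apply/hermmxP; rewrite !trmxC_mul trmxCK mulmxA; congr (_ *m _ *m _).
  by rewrite -[in RHS](blk_herm X) map_trmx trmxK.
have [_ PC _] := CkP k; have CsP : (Ck k)^t* *m pf_P k = (Ck k)^t*.
  by have /hermmxP Ph := pf_herm k; rewrite -{1}Ph -trmxC_mul PC.
by rewrite !mulmxA PC -mulmxA CsP.
Qed.

Lemma blk_sum_proj (R : realType) (Q : projfam R) (X : blkmx Q) :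
  (\sum_k pf_P k) *m blk_val X *m (\sum_k pf_P k) = blk_val X.
Proof. by rewrite -blk_pinch pinch_sum_mul pinch_mul_sum. Qed.

(* A transpose on [M_A]; the entrywise transpose need not preserve [M_A], since
   the projections are not assumed to be real. *)
Lemma exists_blk_transpose (R : realType) (Q : projfam R) :
  exists (C : 'M[R[i]]_(pf_N Q)) (tau : blkmx Q -> blkmx Q),
  [/\ forall X, blk_val (tau X) = C *m (blk_val X)^T *m C^t*,
      forall X, C^t* *m blk_val (tau X) *m C = (blk_val X)^T,
      involutive tau & forall X Y, trf (tau X) Y = trf X (tau Y)].
Proof.
have [C [CT CC CX]] := projfam_conj Q.
have CsT : (C^t*)^T = C^t* by rewrite map_trmx !CT.
have CsC : C^t* *m C = (\sum_k pf_P k)^T.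
  by rewrite -CC trmx_mul CsT; congr (_ *m _); exact: esym.
exists C, (fun X => BlkMx (CX X)); move: CC CsT CsC => /=.
set D := C^t* => CC CsT CsC; split=> //= [X|X|X Y].
- rewrite !mulmxA CsC -[_ *m D *m C]mulmxA CsC -!trmx_mul.
  by rewrite mulmxA blk_sum_proj.
- apply: val_inj => /=; rewrite !trmx_mul trmxK CsT CT !mulmxA CC -!mulmxA.
  by rewrite CC mulmxA blk_sum_proj.
rewrite /trf; congr complex.Re => /=.
rewrite -[LHS]mxtrace_tr !trmx_mul trmxK CsT CT !mulmxA.
by rewrite mxtrace_mulC !mulmxA mxtrace_mulC !mulmxA.
Qed.

(** * Linear action of processes on states, and effects as functionals *)

Lemma linear_comb (R : pzRingType) (V W : lmodType R) (F : V -> W) (I : Type)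
    (s : seq I) (a : I -> R) (v : I -> V) : linear F ->
  F (\sum_(k <- s) a k *: v k) = \sum_(k <- s) a k *: F (v k).
Proof.
move=> Flin; have F0 : F 0 = 0.
  by have := Flin (-1) 0 0; rewrite scaleN1r oppr0 addr0 scaleN1r addNr.
by elim/big_rec2: _ => [|k y z _ <-]; [exact: F0|exact: Flin].
Qed.

Lemma eq_linearV (R : realType) (T : preopt R) (A B : T) (W : lmodType R)
    (F G : V A B -> W) : linear F -> linear G ->
  (forall f, F (vec f) = G (vec f)) -> F =1 G.
Proof.
move=> Flin Glin FG x; have [s ->] := V_combP x.
by rewrite !linear_comb //; apply: eq_bigr => p _; rewrite FG.
Qed.

Definition post (R : realType) (T : preopt R) (A B : T) (f : proc A B) :
  V triv A -> V triv B := lext (fun rho => vec (seqp f rho)).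

Lemma post_compat (R : realType) (T : preopt R) (A B : T) (f : proc A B) :
  vec_compat (fun rho : St A => vec (seqp f rho)).
Proof.
move=> s t st; have := vec_sandwich f (idp triv) st.
under eq_bigr do rewrite compp1.
by under [X in _ = X -> _]eq_bigr do rewrite compp1.
Qed.

Lemma post_linear (R : realType) (T : preopt R) (A B : T) (f : proc A B) :
  linear (post f).
Proof. by have [] := lextE (post_compat f). Qed.

HB.instance Definition _ (R : realType) (T : preopt R) (A B : T)
    (f : proc A B) :=
  GRing.isLinear.Build R (V triv A) (V triv B) _ (post f) (post_linear f).

Lemma post_vec (R : realType) (T : preopt R) (A B : T) (f : proc A B)
    (rho : St A) : post f (vec rho) = vec (seqp f rho).
Proof. exact: (proj2 (lextE (post_compat f))). Qed.

(** For a state, [dpre u] is just a state [kappa] of the ancilla, since tensoring with the trivial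
    system changes nothing; preparing [kappa] and applying [dpost u] is an effect. *)
Lemma dapp_state (R : realType) (T : preopt R) (A : T) (u : sdiagram triv A) :
  exists e : Eff A, forall rho : St A, dapp u rho = seqp e rho.
Proof.
pose kappa : St (anc u) := castp erefl (tens1s (anc u)) (dpre u).
exists (seqp (dpost u) (castp (tenss1 A) erefl (par (idp A) kappa))) => rho.
rewrite -seqpA -tens_st_r tens_st_l /dapp; congr seqp.
by rewrite /kappa -(castp_comp erefl (tens1s _) erefl).
Qed.

Lemma pairing_eq0 (R : realType) (T : preopt R) (A : T) (x : V triv A) :
  (forall e, pairing e x = 0) -> x = 0.
Proof.
move=> x0; apply: val_inj; apply/funext => u; rewrite /=.
have [e uE] := dapp_state u; have [_ plin pE] := pairingE A.
have := x0 (vec e); have [s ->] := V_combP x.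
rewrite (linear_comb _ _ _ (plin (vec e))) => E.
transitivity (0 : R) => //; rewrite V_sumE -[RHS]E.
by apply: eq_bigr => p _; rewrite pE uE.
Qed.

(** The pairing separates the vectors of [V triv A], so its matrix [G] has full column rank and the
    row of values of [l] on a basis lies in the row space of [G]. *)
Lemma functional_pairing (R : realType) (T : opt R) (A : T)
    (l : V triv A -> R^o) : linear l -> exists e, forall x, pairing e x = l x.
Proof.
move=> llin.
have [n [phi [phi' phiK phi'K]]] := V_findim triv A.
have [p [psi [psi' psiK psi'K]]] := V_findim A triv.
have [plinl plinr _] := pairingE A.
pose b i := phi' (delta_mx 0 i); pose c j := psi' (delta_mx 0 j).
pose G := \matrix_(j, i) pairing (c j) (b i).
have xE x : x = \sum_i phi x 0 i *: b i.
  apply: (can_inj phiK); rewrite linear_sum {1}[phi x]row_sum_delta.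
  by apply: eq_bigr => i _; rewrite linearZ /= phi'K.
have eE e : e = \sum_j psi e 0 j *: c j.
  apply: (can_inj psiK); rewrite linear_sum {1}[psi e]row_sum_delta.
  by apply: eq_bigr => j _; rewrite linearZ /= psi'K.
have prE e x : pairing e x = \sum_i phi x 0 i * pairing e (b i).
  by rewrite {1}[x]xE (linear_comb _ _ _ (plinr e)).
have plE e x : pairing e x = \sum_j psi e 0 j * pairing (c j) x.
  by rewrite {1}[e]eE (linear_comb _ _ _ (plinl x)).
have Gfull : row_full G.
  rewrite /row_full -mxrank_tr; apply: inj_row_free => u uG0.
  suff : phi' u = 0 by move=> /(congr1 phi); rewrite phi'K linear0.
  apply: pairing_eq0 => e; rewrite plE big1 // => j _.
  have /matrixP/(_ 0 j) := uG0; rewrite !mxE => uGj.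
  rewrite (_ : pairing (c j) _ = 0) ?mulr0 // -uGj prE phi'K.
  by apply: eq_bigr => i _; rewrite !mxE.
have /submxP[y yE] : (\row_i l (b i) <= G)%MS by exact: submx_full.
exists (psi' y) => x; rewrite prE {2}[x]xE (linear_comb _ _ _ llin).
apply: eq_bigr => i _; congr (_ * _).
have /matrixP/(_ 0 i) := yE; rewrite !mxE => ->.
by rewrite plE psi'K; apply: eq_bigr => j _; rewrite mxE.
Qed.

(** The functional is represented by the pairing, and by [diamond] the effects fill the whole dual
    cone. *)
Lemma effect_of_functional (R : realType) (T : opt R) (A : T)
    (l : V triv A -> R^o) : diamond T -> linear l ->
  (forall rho : St A, 0 <= l (vec rho)) ->
  exists e : Eff A, forall x, pairing (vec e) x = l x.
Proof.
move=> dia llin l_ge0; have [e eE] := functional_pairing llin.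
have [_ effE] := dia A.
have : [set e | forall rho : St A, 0 <= pairing e (vec rho)] e.
  by move=> rho; rewrite eE.
by rewrite -effE => -[e' _ e'E]; exists e' => x; rewrite e'E.
Qed.

(** * Tensor products of states and teleportation *)

Lemma tens_st_mapl (T : smcat) (A B C : T) (f : proc A C) (rho : St A)
    (sigma : St B) :
  seqp (par f (idp B)) (tens_st rho sigma) = tens_st (seqp f rho) sigma.
Proof.
by rewrite /tens_st -(castp_comp _ erefl erefl) -par_comp comp1p.
Qed.

Lemma post_vtens (R : realType) (T : preopt R) (A B C : T) (f : proc A C)
    (x : V triv A) (y : V triv B) :
  post (par f (idp B)) (vtens x y) = vtens (post f x) y.
Proof.
have [tl tr tE] := vtensE A B; have [tl' tr' tE'] := vtensE C B.
move: x; apply: eq_linearV => [a x x'|a x x'|rho].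
- by rewrite tl linearP.
- by rewrite linearP tl'.
rewrite post_vec; move: y; apply: eq_linearV => [a y y'|a y y'|sigma].
- by rewrite tr linearP.
- by rewrite tr'.
by rewrite tE post_vec tens_st_mapl tE'.
Qed.

Lemma castp_parr (T : smcat) (A B C C' D D' : T) (eC : C = C') (eD : D = D')
    (f : proc A B) (g : proc C D) :
  par f (castp eC eD g) =
  castp (congr1 (tens A) eC) (congr1 (tens B) eD) (par f g).
Proof. by case: C' / eC; case: D' / eD. Qed.

Lemma par_scal (T : smcat) (A B : T) (x : St B) (s : Scal T) :
  castp (tens1s triv) (tenss1 B) (par x s) = smulp s x.
Proof.
rewrite par_lr (castp_comp _ (tenss1 triv) _).
rewrite parp1 (Prop_irrelevance (tenss1 triv) (tens1s triv)) par1p.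
by rewrite -{1}[s]compp1 -smulp_scal smulp_compl compp1.
Qed.

(** The cast along [tensA] regroups the wires so that [eps] caps the last two. *)
Definition contract (T : smcat) (A B : T) (eps : Eff (tens A A)) :
  proc (tens (tens B A) A) B :=
  castp (tensA B A A) (tenss1 B) (par (idp B) eps).

Lemma contract_tens (T : smcat) (A B : T) (eps : Eff (tens A A)) (x : St B)
    (y rho : St A) :
  seqp (contract B eps) (tens_st (tens_st x y) rho) =
  smulp (seqp eps (tens_st y rho)) x.
Proof.
transitivity (castp (tens1s triv) (tenss1 B)
  (par (seqp (idp B) x) (seqp eps (tens_st y rho)))).
  rewrite par_comp /contract.
  rewrite (castp_comp _ (tensA B A A) _).
  congr seqp; rewrite /tens_st castp_parl -parA castp_parr !castp_trans.
  by congr castp; exact: Prop_irrelevance.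
by rewrite comp1p par_scal.
Qed.

(** The input is placed beside [sigma], then [eps] joins it to the [A] part of [sigma]: a bipartite
    state is turned into a process. *)
Definition teleport (T : smcat) (A B : T) (sigma : St (tens B A))
    (eps : Eff (tens A A)) : proc A B :=
  seqp (contract B eps) (castp (tens1s A) erefl (par sigma (idp A))).

(** For fixed [rho] the output is the image of [sigma] under one process [g], hence linear in
    [sigma]; this reduces the claim to product states, where [contract_tens] applies. *)
Lemma vec_teleport (R : realType) (T : preopt R) (A B : T) n
    (sigma : St (tens B A)) (eps : Eff (tens A A)) (rho : St A)
    (x : 'I_n -> V triv B) (y : 'I_n -> V triv A) :
  vec sigma = \sum_k vtens (x k) (y k) ->
  vec (seqp (teleport sigma eps) rho) =
  \sum_k pairing (vec eps) (vtens (y k) (vec rho)) *: x k.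
Proof.
pose g := seqp (contract B eps)
  (castp (tenss1 (tens B A)) erefl (par (idp (tens B A)) rho)).
have gE tau : seqp g tau = seqp (contract B eps) (tens_st tau rho).
  by rewrite /g -seqpA -tens_st_r.
have -> : seqp (teleport sigma eps) rho = seqp g sigma.
  by rewrite gE /teleport -seqpA -tens_st_l.
have [tl tr tE] := vtensE B A; have [tl' _ tE'] := vtensE A A.
have [_ pl pE] := pairingE (tens A A).
move=> sigmaE; rewrite -post_vec sigmaE linear_sum; apply: eq_bigr => k _ /=.
move: (x k) (y k) => {x y k sigmaE}x y.
move: x; apply: eq_linearV => [a x x'|a x x'|b].
- by rewrite tl linearP.
- by rewrite scalerDr !scalerA mulrC.
move: y; apply: eq_linearV => [a y y'|a y y'|c].
- by rewrite tr linearP.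
- by rewrite tl' pl scalerDl scalerA.
by rewrite tE tE' pE post_vec gE contract_tens vec_smulp.
Qed.

(** * States and effects as positive matrices *)

Lemma psd_state (R : realType) (T : opt R) (m : matrep T) (A : T)
    (rho : St A) : psd (blk_val (mr_M m A (vec rho))).
Proof.
suff : [set X : blkmx (mr_P m A) | psd (blk_val X)] (mr_M m A (vec rho)) by [].
by rewrite -mr_St; exists (vec rho) => //; exists rho.
Qed.

Lemma state_of_psd (R : realType) (T : opt R) (m : matrep T) (A : T)
    (x : V triv A) :
  psd (blk_val (mr_M m A x)) -> exists rho : St A, vec rho = x.
Proof.
move=> xpsd.
have : [set X : blkmx (mr_P m A) | psd (blk_val X)] (mr_M m A x) by [].
rewrite -mr_St => -[_ [rho _ <-]] rhoE; exists rho.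
exact: (bij_inj (mr_bij m A)) rhoE.
Qed.

Lemma castmx_sum (K : nmodType) (p q : nat) (e : p = q) n
    (F : 'I_n -> 'M[K]_p) :
  castmx (e, e) (\sum_k F k) = \sum_k castmx (e, e) (F k).
Proof. by case: q / e; under [RHS]eq_bigr do rewrite castmx_id; rewrite castmx_id. Qed.

Lemma castmx_mr_tens (R : realType) (T : opt R) (m : matrep T) (A B : T) n
    (x : 'I_n -> V triv A) (y : 'I_n -> V triv B) :
  castmx (mr_N m A B, mr_N m A B)
    (blk_val (mr_M m (tens A B) (\sum_k vtens (x k) (y k)))) =
  \sum_k blk_val (mr_M m A (x k)) *t blk_val (mr_M m B (y k)).
Proof.
rewrite linear_sum blk_val_sum castmx_sum.
by apply: eq_bigr => k _; rewrite mr_M_tens.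
Qed.

Lemma psd_mr_tens (R : realType) (T : opt R) (m : matrep T) (A B : T) n
    (x : 'I_n -> V triv A) (y : 'I_n -> V triv B) :
  psd (blk_val (mr_M m (tens A B) (\sum_k vtens (x k) (y k)))) <->
  psd (\sum_k blk_val (mr_M m A (x k)) *t blk_val (mr_M m B (y k))).
Proof. by rewrite -castmx_mr_tens psd_castmx. Qed.

Lemma trf_psd_ge0 (R : realType) (Q : projfam R) (X Y : blkmx Q) :
  psd (blk_val X) -> psd (blk_val Y) -> 0 <= trf X Y.
Proof. by move=> Xpsd Ypsd; rewrite -ler0c trfE psd_trM_ge0. Qed.

(** Self-duality of the positive cone: the trace form against [X] is nonnegative on the matrices of
    states. *)
Lemma effect_of_psd (R : realType) (T : opt R) (m : matrep T) (A : T)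
    (X : blkmx (mr_P m A)) : diamond T -> psd (blk_val X) ->
  exists e : Eff A, forall x, pairing (vec e) x = trf X (mr_M m A x).
Proof.
move=> dia Xpsd; apply: effect_of_functional => // [a x y|rho].
  by rewrite linearP trf_linear.
by apply: trf_psd_ge0 => //; exact: psd_state.
Qed.

Lemma trf_mr_tens (R : realType) (T : opt R) (m : matrep T) (A B : T) n
    (x : 'I_n -> V triv A) (y : 'I_n -> V triv B) (x' : V triv A)
    (y' : V triv B) :
  trf (mr_M m (tens A B) (\sum_k vtens (x k) (y k)))
      (mr_M m (tens A B) (vtens x' y')) =
  \sum_k trf (mr_M m A (x k)) (mr_M m A x') *
         trf (mr_M m B (y k)) (mr_M m B y').
Proof.
have tr_cast p q (e : p = q) (X Y : 'M[R[i]]_p) :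
    \tr (X *m Y) = \tr (castmx (e, e) X *m castmx (e, e) Y).
  by case: q / e; rewrite !castmx_id.
apply: complexI; rewrite trfE (tr_cast _ _ (mr_N m A B)) castmx_mr_tens.
rewrite mr_M_tens mulmx_suml raddf_sum rmorph_sum /=; apply: eq_bigr => k _.
by rewrite tensmx_mul tr_tens rmorphM /= !trfE.
Qed.

(** Coordinates on the block matrices are transported from [V triv A] along the inverse of
    [mr_M]. *)
Lemma mr_dual_bases (R : realType) (T : opt R) (m : matrep T) (A : T) :
  exists (n : nat) (b c : 'I_n -> blkmx (mr_P m A)),
    forall X, X = \sum_k trf (c k) X *: b k.
Proof.
have [n [phi phi_bij]] := V_findim triv A.
have [g MK gK] := mr_bij m A.
have phig_lin : linear (phi \o g).
  move=> a X Y /=; rewrite -linearP; congr (phi _).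
  by apply: (can_inj MK); rewrite gK linearP !gK.
pose phig : {linear blkmx (mr_P m A) -> 'rV[R]_n} :=
  HB.pack (phi \o g) (GRing.isLinear.Build _ _ _ _ _ phig_lin).
have phig_bij : bijective phig by apply: bij_comp => //; exists (mr_M m A).
have [b [c bc]] := trf_dual_bases phig_bij.
by exists n, b, c.
Qed.

(** * Choi matrices and complete positivity *)

Lemma tensmx_suml (K : pzRingType) p q r s n (F : 'I_n -> 'M[K]_(p, q))
    (Z : 'M[K]_(r, s)) : (\sum_k F k) *t Z = \sum_k F k *t Z.
Proof.
apply/matrixP => i j; rewrite mxE !summxE mulr_suml.
by apply: eq_bigr => k _; rewrite mxE.
Qed.

(** Apply complete positivity, with ancilla dimension [pf_N Q], to the positive matrix of
    [dual_bases_choi_psd]. *)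
Lemma choi_of_CP (R : realType) (Q Q' : projfam R) n (b c : 'I_n -> blkmx Q)
    (L : blkmx Q -> blkmx Q') :
  (forall X, X = \sum_k trf (c k) X *: b k) -> CP Q Q' L ->
  psd (\sum_k blk_val (L (b k)) *t (blk_val (c k))^T).
Proof.
move=> bc [_ /(_ _ [seq (b k, (blk_val (c k))^T) | k <- index_enum 'I_n])].
rewrite !big_map; apply; last exact: dual_bases_choi_psd.
apply/allP => _ /mapP[k _ ->]; apply/hermmxP.
by rewrite /= -map_trmx blk_herm.
Qed.

(** Kraus operators [W j] of [L] turn its ampliation into a sum of congruences by [W j *t 1%:M]. *)
Lemma CP_of_choi (R : realType) (Q Q' : projfam R) n (b c : 'I_n -> blkmx Q)
    (L : blkmx Q -> blkmx Q') :
  (forall X, X = \sum_k trf (c k) X *: b k) -> linear L ->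
  psd (\sum_k blk_val (L (b k)) *t (blk_val (c k))^T) -> CP Q Q' L.
Proof.
move=> bc Llin /kraus_of_choi[W WE]; split=> // d s _ spsd.
have LE X : blk_val (L X) = \sum_j W j *m blk_val X *m (W j)^t*.
  rewrite -WE {1}[X]bc (linear_comb _ _ _ Llin) blk_val_sum.
  by apply: eq_bigr => k _; rewrite -trfE.
have -> : \sum_(p <- s) blk_val (L p.1) *t p.2 =
    \sum_j (W j *t 1%:M) *m (\sum_(p <- s) blk_val p.1 *t p.2) *m
           (W j *t 1%:M)^t*.
  under [RHS]eq_bigr do rewrite mulmx_sumr mulmx_suml.
  rewrite exchange_big; apply: eq_bigr => p _ /=.
  rewrite LE tensmx_suml; apply: eq_bigr => k _.
  by rewrite trmxC_tens trmx1 map_mx1 !tensmx_mul mulmx1 mul1mx.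
by apply: psd_sum => j; exact: psd_congr.
Qed.

Lemma psd_tens_congr (R : realType) p q n (C : 'M[R[i]]_q)
    (B : 'I_n -> 'M[R[i]]_p) (Y Z : 'I_n -> 'M[R[i]]_q) :
  (forall k, Z k = C *m Y k *m C^t*) ->
  psd (\sum_k B k *t Y k) -> psd (\sum_k B k *t Z k).
Proof.
move=> ZE /(psd_congr (1%:M *t C)).
rewrite mulmx_sumr mulmx_suml trmxC_tens trmx1 map_mx1.
by under eq_bigr do rewrite !tensmx_mul mulmx1 mul1mx -ZE.
Qed.

Theorem theorem44 (R : realType) (T : opt R) (m : matrep T)
    (hdiamond : diamond T) (hlocal : local_equality T) (A B : T) :
  (exists L : proc A B -> (blkmx (mr_P m A) -> blkmx (mr_P m B)),
     cone_iso (CP (mr_P m A) (mr_P m B)) L) /\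
  (exists L : proc A B -> (blkmx (mr_P m A) -> blkmx (mr_P m B)),
     cone_iso (CP (mr_P m A) (mr_P m B)) L /\
     forall (f : proc A B) (rho : St A),
       mr_M m B (vec (seqp f rho)) = L f (mr_M m A (vec rho))).
Proof.
set goal2 := (X in _ /\ X).
suff : goal2 by move=> gL; split=> //; case: gL => L [L_iso _]; exists L.
have [gA MA_K gA_K] := mr_bij m A; have [gB MB_K gB_K] := mr_bij m B.
have gA_lin : linear gA.
  by move=> a X Y; apply: (can_inj MA_K); rewrite gA_K linearP !gA_K.
have [n [b [c bc]]] := mr_dual_bases m A.
have [C [tau [tauE tau_inv tauK tau_adj]]] := exists_blk_transpose (mr_P m A).
(* Choi matrices carry the entrywise transpose, whereas elements of the tensor product need a second
   factor in [blkmx]; congruences by [C] and [C^t*] pass from one to the other. *)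
have tau_psd p (F : 'I_n -> 'M[R[i]]_p) :
    psd (\sum_k F k *t blk_val (tau (c k))) <->
    psd (\sum_k F k *t (blk_val (c k))^T).
  split; last by apply: psd_tens_congr => k; exact: tauE.
  by apply: (@psd_tens_congr _ _ _ _ (C^t*)) => k; rewrite trmxCK tau_inv.
pose L (f : proc A B) X := mr_M m B (post f (gA X)).
have LE f rho : mr_M m B (vec (seqp f rho)) = L f (mr_M m A (vec rho)).
  by rewrite /L MA_K post_vec.
have L_lin f : linear (L f).
  by move=> a X Y; rewrite /L gA_lin !linearP.
exists L; split=> //.
pose Phi := \sum_k vtens (gA (b k)) (gA (tau (c k))).
have Phi_psd : psd (blk_val (mr_M m (tens A A) Phi)).
  apply/psd_mr_tens; under eq_bigr do rewrite !gA_K.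
  exact/tau_psd/dual_bases_choi_psd.
have L_CP f : CP _ _ (L f).
  apply: (CP_of_choi bc (L_lin f)).
  apply: (proj1 (tau_psd _ (fun k => blk_val (L f (b k))))).
  have [eta etaE] := state_of_psd Phi_psd.
  (* The state [f (x) id] applied to [eta] has the matrix [\sum_k L f (b k) *t tau (c k)], up to a
     cast. *)
  have := psd_state m (seqp (par f (idp A)) eta).
  rewrite -post_vec etaE (linear_sum (post (par f (idp A)))) /=.
  under eq_bigr do rewrite post_vtens.
  by move=> /psd_mr_tens; under [X in psd X -> _]eq_bigr do rewrite gA_K.
have [eps epsPhi] := effect_of_psd hdiamond Phi_psd.
(* Adjointness moves [tau] onto the matrix of [y], and the resulting matrix is expanded in the basis
   [b]. *)
have epsE x y : pairing (vec eps) (vtens x y) =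
    trf (tau (mr_M m A x)) (mr_M m A y).
  rewrite epsPhi trf_mr_tens tau_adj [tau _]bc.
  rewrite (linear_comb _ _ _ (@trf_linear _ _ _)).
  by apply: eq_bigr => k _; rewrite !gA_K tau_adj mulrC (trfC (b k)).
split=> [f g fg||f g|a f].
- apply: hlocal => rho e; congr seqp; apply: vec_inj.
  by apply: (can_inj MB_K); rewrite !LE fg.
- apply/seteqP; split=> [_ [f _ <-] //|K K_CP].
  have [|sigma sigmaE] := @state_of_psd _ _ m (tens B A)
      (\sum_k vtens (gB (K (b k))) (gA (tau (c k)))).
    apply/psd_mr_tens; under eq_bigr do rewrite gB_K gA_K.
    exact/tau_psd/choi_of_CP.
  have [K_lin _] := K_CP.
  exists (teleport sigma eps) => //; apply/funext => X.
  rewrite -(gA_K X); apply: (eq_linearV (F := fun x => L _ (mr_M m A x))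
      (G := fun x => K (mr_M m A x))) => [t x y|t x y|rho].
  + by rewrite linearP L_lin.
  + by rewrite linearP K_lin.
  (* By [epsE] the coefficient of [K (b k)] is the trace form of [tau (tau (c k)) = c k] with the
     matrix of [rho], so the sum is [K] applied to the expansion of that matrix. *)
  rewrite -LE (vec_teleport _ _ sigmaE) linear_sum.
  rewrite [mr_M m A (vec rho) in RHS]bc (linear_comb _ _ _ K_lin).
  apply: eq_bigr => k _; rewrite linearZ /= gB_K epsE; congr (_ *: _).
  by rewrite gA_K tauK.
- apply/funext => X; rewrite -(gA_K X).
  apply: (eq_linearV (F := fun x => L (addp f g) (mr_M m A x))
      (G := fun x => L f (mr_M m A x) + L g (mr_M m A x))) => [t x y|t x y|rho].
  + by rewrite linearP L_lin.
  + by rewrite linearP !L_lin scalerDr addrACA.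
  rewrite -!LE -linearD; congr (mr_M m B _).
  (* The two lists encode the relation [vec (addp f g) = vec f + vec g], which composition with
     [rho] preserves. *)
  have := @vec_sandwich _ _ _ _ _ _ (idp B) rho [:: (1, addp f g)]
    [:: (1, f); (1, g)].
  rewrite !big_cons !big_nil /= !scale1r !addr0 vec_addp !comp1p.
  exact.
apply/funext => X; rewrite -(gA_K X).
apply: (eq_linearV (F := fun x => L (smulp a f) (mr_M m A x))
    (G := fun x => scal a *: L f (mr_M m A x))) => [t x y|t x y|rho].
- by rewrite linearP L_lin.
- by rewrite linearP !L_lin scalerDr !scalerA mulrC.
by rewrite -!LE smulp_compr vec_smulp linearZ.
Qed.
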